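(* Let $n\ge 3$ and let $X$ be an $A_n^2$-polyhedron of finite type. If $H_n(X)=\mathbb{Z}^2\oplus G$ for a certain abelian group $G$, then $\mathcal{B}^{n+2}(X)$ is an infinite group.
   Context: An $A_n^2$-polyhedron ($n\ge 2$) is an $(n-1)$-connected, $(n+2)$-dimensional CW-complex. It is of finite type when it has finitely many cells in each dimension up to homotopy; in particular its homology groups $H_i(X)$ and homotopy groups $\pi_i(X)$, $i\ge 1$, are finitely generated abelian groups. Homology has integer coefficients. For $n\ge 3$ put $\Gamma_n^1=-\otimes\mathbb{Z}_2$ (as a functor on abelian groups). The $\Gamma$-sequence of an $A_n^2$-polyhedron $X$, $n\ge 3$, is the final part of Whitehead's exact sequence, $$H_{n+2}(X)\xrightarrow{b_{n+2}}\Gamma_n^1(H_n(X))\xrightarrow{i_n}\pi_{n+1}(X)\xrightarrow{h_{n+1}}H_{n+1}(X)\to 0,$$ where $h_{n+1}$ is the Hurewicz homomorphism. Here $\Gamma_n^1(H_n(X))$ is naturally identified with $\Gamma_{n+1}(X)=\operatorname{Im}(\pi_{n+1}(X^n)\to\pi_{n+1}(X^{n+1}))$, where $X^k$ is the $k$-skeleton; under $H_n(X)\cong\pi_n(X)$ the identification is induced by precomposition with the (suspended) Hopf map $S^{n+1}\to S^n$. The map $i_n$ is induced by inclusion $X^{n+1}\subset X$. The map $b_{n+2}$ represents the attaching maps: it is induced by restricting the boundary $\pi_{n+2}(X^{n+2},X^{n+1})\to\pi_{n+1}(X^{n+1})$ to cellular cycles. $\mathcal{B}^{n+2}(X)$ is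 the group (under composition) of $\Gamma$-isomorphisms of the $\Gamma$-sequence of $X$, i.e. of triples $(f_{n+2},f_{n+1},f_n)$ with $f_i\in\operatorname{Aut}(H_i(X))$ for which there exists a homomorphism $\Omega\colon\pi_{n+1}(X)\to\pi_{n+1}(X)$ with $b_{n+2}f_{n+2}=\Gamma_n^1(f_n)b_{n+2}$, $\Omega\, i_n=i_n\Gamma_n^1(f_n)$ and $h_{n+1}\Omega=f_{n+1}h_{n+1}$ ($\Omega$ is not part of the data). *)

(* Defs.v *)
From HB Require Import structures.
From mathcomp Require Import all_boot all_order all_algebra ring lra.
From mathcomp Require Import all_classical all_reals topology normedtype.
From mathcomp Require Import freeg.
Set Implicit Arguments.
Unset Strict Implicit.
Unset Printing Implicit Defensive.
Import Order.TTheory GRing.Theory Num.Theory.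
Import numFieldNormedType.Exports.
Local Open Scope classical_set_scope.
Local Open Scope ring_scope.
Local Open Scope quotient_scope.

Definition cmap (X Y : topologicalType) (f : X -> Y) (cf : continuous f) :
  continuousType X Y := mkcts cf.

Definition ccomp (X Y Z : topologicalType) (g : continuousType Y Z)
  (f : continuousType X Y) : continuousType X Z := g \o f.

Section Paste.
Context {R : realType} {T Y : topologicalType}.

Lemma continuous_paste (phi : T -> R) (c : R) (f g : T -> Y) :
  continuous phi -> continuous f -> continuous g ->
  (forall t, phi t = c -> f t = g t) ->
  continuous (fun t => if phi t <= c then f t else g t).
Proof.
move=> cphi cf cg fg.
pose h t := if phi t <= c then f t else g t; rewrite -/h.
pose A := phi @^-1` [set x | x <= c]; pose B := phi @^-1` [set x | c <= x].
have clA : closed A by apply: preimage_closed => //; exact: closed_le.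
have clB : closed B by apply: preimage_closed => //; exact: closed_ge.
have AB : A `|` B = setT.
  apply/seteqP; split => // t _; rewrite /A /B /=.
  by case: (leP (phi t) c) => [|/ltW]; [left|right].
apply/continuous_subspace_setT; rewrite -AB.
apply: withinU_continuous => //.
- apply: (@subspace_eq_continuous _ _ _ f); last exact: continuous_subspaceT.
  by move=> t /set_mem; rewrite /A /= => tc; rewrite /from_subspace /h tc.
- apply: (@subspace_eq_continuous _ _ _ g); last exact: continuous_subspaceT.
  move=> t /set_mem; rewrite /B /= => ct; rewrite /from_subspace /h; case: ifP => // tc.
  by rewrite fg //; apply/eqP; rewrite eq_le tc ct.
Qed.

End Paste.

Section RealContinuity.
Context {R : realType} {T : topologicalType}.
Implicit Types f g : T -> R.

Lemma ctsD f g : continuous f -> continuous g -> continuous (fun t => f t + g t).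
Proof. by move=> cf cg t; apply: (@continuousD R R^o T f g t (cf t) (cg t)). Qed.

Lemma ctsN f : continuous f -> continuous (fun t => - f t).
Proof. by move=> cf t; apply: (@continuousN R R^o T f t (cf t)). Qed.

Lemma ctsM f g : continuous f -> continuous g -> continuous (fun t => f t * g t).
Proof. by move=> cf cg t; apply: (@continuousM R T f g t (cf t) (cg t)). Qed.

Lemma ctsC (c : R) : continuous (fun _ : T => c).
Proof. by move=> t; exact: cvg_cst. Qed.

Lemma ctsmin f g :
  continuous f -> continuous g -> continuous (fun t => Num.min (f t) (g t)).
Proof. by move=> cf cg t; apply: (@continuous_min R T f g t (cf t) (cg t)). Qed.

Lemma ctsmax f g :
  continuous f -> continuous g -> continuous (fun t => Num.max (f t) (g t)).
Proof. by move=> cf cg t; apply: (@continuous_max R T f g t (cf t) (cg t)). Qed.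

End RealContinuity.
Arguments ctsC {R T} c x.

Lemma cts_comp (X Y Z : topologicalType) (f : X -> Y) (g : Y -> Z) :
  continuous f -> continuous g -> continuous (fun x => g (f x)).
Proof. by move=> cf cg x; apply: continuous_comp; [exact: cf|exact: cg]. Qed.

Lemma cts_comp2 (X Y Z W : topologicalType) (a : X -> Y) (b : X -> Z)
    (H : Y * Z -> W) :
  continuous a -> continuous b -> continuous H -> continuous (fun x => H (a x, b x)).
Proof.
move=> ca cb cH x; apply: (@continuous_comp _ _ _ (fun x => (a x, b x)) H).
  by apply: cvg_pair; [exact: ca|exact: cb].
exact: cH.
Qed.

Lemma cts_fst (X Y : topologicalType) : continuous (@fst X Y).
Proof. by move=> x; exact: cvg_fst. Qed.

Lemma cts_snd (X Y : topologicalType) : continuous (@snd X Y).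
Proof. by move=> x; exact: cvg_snd. Qed.

Section Cube.
Context (R : realType).

Definition cube_set (k : nat) : set 'rV[R]_k :=
  [set t | forall i, 0 <= t ord0 i <= 1].
Arguments cube_set : clear implicits.

(* The cube I^k = [0,1]^k with the subspace topology of R^k. *)
Definition cube (k : nat) : topologicalType := cube_set k.

Definition crd (k : nat) (t : cube k) (i : 'I_k) : R := (val t : 'rV[R]_k) ord0 i.

Definition clamp (x : R) : R := Num.max 0 (Num.min 1 x).

Lemma clamp_in (x : R) : 0 <= clamp x <= 1.
Proof.
rewrite /clamp le_max lexx /= ge_max ler01 /=.
by rewrite ge_min lexx.
Qed.

Lemma clampE (x : R) : 0 <= x <= 1 -> clamp x = x.
Proof. by case/andP => x0 x1; rewrite /clamp min_r // max_r. Qed.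

Lemma to_cube_subproof (k : nat) (v : 'I_k -> R) :
  (\row_i clamp (v i)) \in cube_set k.
Proof. by apply/mem_set => i; rewrite mxE clamp_in. Qed.

(* The point with coordinates v; clamping only serves to make this total. *)
Definition to_cube (k : nat) (v : 'I_k -> R) : cube k :=
  exist _ (\row_i clamp (v i)) (to_cube_subproof v).

Lemma crd_in (k : nat) (t : cube k) i : 0 <= crd t i <= 1.
Proof. exact: (set_mem (valP t)). Qed.

Lemma to_cubeE (k : nat) (v : 'I_k -> R) i : crd (to_cube v) i = clamp (v i).
Proof. by rewrite /crd /= mxE. Qed.

Lemma cubeP (k : nat) (t u : cube k) : (forall i, crd t i = crd u i) -> t = u.
Proof. by move=> tu; apply/val_inj/rowP => i; apply: tu. Qed.

Lemma crd_continuous k i : continuous (fun t : cube k => crd t i).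
Proof.
move=> t; apply: (@continuous_comp _ _ _ (@set_val _ (cube_set k)) (fun M : 'rV[R]_k => M ord0 i)).
  exact: initial_continuous.
exact: coord_continuous.
Qed.

Lemma to_cube_continuous (T : topologicalType) k (v : T -> 'I_k -> R) :
  (forall i, continuous (fun t => v t i)) -> continuous (fun t => to_cube (v t)).
Proof.
move=> cv; apply: continuous_comp_initial => t U [P Pt PU].
have cc i : continuous (fun t => clamp (v t i)).
  exact: ctsmax (ctsC 0) (ctsmin (ctsC 1) (cv i)).
apply: (@filterS _ _ _ (fun u => forall i, P ord0 i (clamp (v u i)))).
  by move=> u Pu; apply: PU => i j; rewrite !ord1 /= mxE; exact: Pu.
apply: filter_forall => i.
by apply: (cc i t); have := Pt ord0 i; rewrite /= mxE.
Qed.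
End Cube.

Section Homotopy.
Context (R : realType).

Definition unit_interval : topologicalType := `[0 : R, 1 : R]%classic.

(* Homotopy from f to g, stationary on A. *)
Definition homotopic_rel (X Y : topologicalType) (A : set X) (f g : X -> Y) :=
  exists H : continuousType (X * unit_interval)%type Y,
  [/\ forall x s, val s = 0 -> H (x, s) = f x,
      forall x s, val s = 1 -> H (x, s) = g x &
      forall x s, A x -> H (x, s) = f x].

Lemma homotopic_rel_ext (X Y : topologicalType) (A : set X) (f g : X -> Y) :
  homotopic_rel A f g ->
  exists H : X * R -> Y,
  [/\ continuous H, forall x, H (x, 0) = f x, forall x, H (x, 1) = g x &
      forall x s, A x -> H (x, s) = f x].
Proof.
move=> [H [H0 H1 HA]].
have clI (s : R) : clamp s \in `[0 : R, 1 : R]%classic.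
  by apply/mem_set; rewrite /= in_itv /= clamp_in.
pose c (s : R) : unit_interval := exist _ (clamp s) (clI s).
have cc : continuous c.
  apply: continuous_comp_initial.
  exact: ctsmax (ctsC 0) (ctsmin (ctsC 1) (fun x => cvg_id)).
exists (fun p => H (p.1, c p.2)); split.
- exact: cts_comp2 (@cts_fst _ _) (cts_comp (@cts_snd _ _) cc) (@cts_fun _ _ H).
- by move=> x; apply: H0; rewrite /= clampE // lexx ler01.
- by move=> x; apply: H1; rewrite /= clampE // lexx ler01.
- by move=> x s Ax; apply: HA.
Qed.

Lemma homotopic_relI (X Y : topologicalType) (A : set X) (f g : X -> Y)
    (H : X * R -> Y) :
  continuous H -> (forall x, H (x, 0) = f x) -> (forall x, H (x, 1) = g x) ->
  (forall x s, 0 <= s <= 1 -> A x -> H (x, s) = f x) -> homotopic_rel A f g.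
Proof.
move=> cH H0 H1 HA.
have cK : continuous (fun p : X * unit_interval => H (p.1, val p.2)).
  apply: cts_comp2 (@cts_fst _ _) _ cH.
  apply: cts_comp (@cts_snd _ _) _; exact: initial_continuous.
exists (cmap cK); split=> /=.
- by move=> x s s0; rewrite /cmap /mkcts /= s0 H0.
- by move=> x s s0; rewrite /cmap /mkcts /= s0 H1.
- move=> x s Ax; rewrite /cmap /mkcts /= HA //.
  by have := set_mem (valP s); rewrite /= in_itv.
Qed.

Section Equiv.
Variables (X Y : topologicalType) (A : set X).
Implicit Types f g h : X -> Y.

Lemma homotopic_refl f : continuous f -> homotopic_rel A f f.
Proof.
move=> cf; apply: (@homotopic_relI _ _ _ _ _ (fun p => f p.1)) => //.
exact: cts_comp (@cts_fst _ _) cf.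
Qed.

Lemma homotopic_sym f g : homotopic_rel A f g -> homotopic_rel A g f.
Proof.
move=> /homotopic_rel_ext[H [cH H0 H1 HA]].
have HA1 x : A x -> f x = g x by move=> Ax; rewrite -H1 HA.
apply: (@homotopic_relI _ _ _ _ _ (fun p => H (p.1, 1 - p.2))).
- exact: cts_comp2 (@cts_fst _ _) (ctsD (ctsC 1) (ctsN (@cts_snd _ _))) cH.
- by move=> x /=; rewrite subr0.
- by move=> x /=; rewrite subrr.
- by move=> x s /andP[s0 s1] Ax /=; rewrite HA ?HA1.
Qed.

Lemma homotopic_trans f g h :
  homotopic_rel A f g -> homotopic_rel A g h -> homotopic_rel A f h.
Proof.
move=> /homotopic_rel_ext[H [cH H0 H1 HA]] /homotopic_rel_ext[G [cG G0 G1 GA]].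
have HA1 x : A x -> f x = g x by move=> Ax; rewrite -H1 HA.
apply: (@homotopic_relI _ _ _ _ _ (fun p =>
  if p.2 <= 2^-1 then H (p.1, 2 * p.2) else G (p.1, 2 * p.2 - 1))).
- apply: continuous_paste (@cts_snd _ _) _ _ _.
  + exact: cts_comp2 (@cts_fst _ _) (ctsM (ctsC 2) (@cts_snd _ _)) cH.
  + apply: cts_comp2 (@cts_fst _ _) _ cG.
    exact: ctsD (ctsM (ctsC 2) (@cts_snd _ _)) (ctsC (-1)).
  + move=> [x s] /= ->; rewrite (_ : 2 * 2^-1 = 1) ?subrr ?H1 ?G0 //; by field.
- by move=> x /=; rewrite mulr0 H0 ifT // invr_ge0.
- move=> x /=; rewrite ifF; first by rewrite (_ : 2 * 1 - 1 = 1) ?G1 //; ring.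
  by apply/negbTE; rewrite -ltNge; lra.
- move=> x s /andP[s0 s1] Ax /=; case: ifPn; rewrite -?ltNge => s2.
    by rewrite HA.
  by rewrite GA ?HA1.
Qed.
End Equiv.
End Homotopy.

Lemma cts_idfun (U : topologicalType) : continuous (fun x : U => x).
Proof. by move=> x; exact: cvg_id. Qed.

Section HomotopyGroup.
Context (R : realType).

Definition cube_bd (k : nat) : set (cube R k) :=
  [set t | exists i, crd t i = 0 \/ crd t i = 1].

Section Loops.
Variables (X : topologicalType) (x0 : X) (k : nat).

(* Maps (I^k, boundary of I^k) -> (X, x0). *)
Definition loop_set : set (continuousType (cube R k) X) :=
  [set f | forall t, cube_bd t -> f t = x0].

Definition loop : choiceType := loop_set.

Lemma loopP (l : loop) t : cube_bd t -> val l t = x0.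
Proof. exact: (set_mem (valP l)). Qed.

Definition mkloop (f : cube R k -> X) (cf : continuous f)
  (bf : forall t, cube_bd t -> f t = x0) : loop :=
  exist _ (cmap cf) (mem_set (bf : loop_set (cmap cf))).

Definition loop_homotopic (f g : loop) : bool :=
  `[< homotopic_rel R (@cube_bd k) (val f) (val g) >].

Lemma loop_homotopic_equiv : equiv_class_of loop_homotopic.
Proof.
split.
- by move=> f; apply/asboolP/homotopic_refl/cts_fun.
- by move=> f g; apply/asboolP/asboolP => /homotopic_sym.
- move=> g f h /asboolP fg /asboolP gh; apply/asboolP.
  exact: homotopic_trans fg gh.
Qed.

Canonical loop_homotopic_equivRel := EquivRelPack loop_homotopic_equiv.

(* pi_k(X, x0).  It is a groupType in positive degree k.+1, written
   multiplicatively; in degree 0 it is the set of path components. *)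
Definition homotopy_group := {eq_quot loop_homotopic}.

HB.instance Definition _ : EqQuotient loop loop_homotopic homotopy_group :=
  EqQuotient.on homotopy_group.
HB.instance Definition _ := Choice.on homotopy_group.

Definition htpy_class (f : loop) : homotopy_group := \pi_homotopy_group f.

Lemma htpy_classP f g :
  htpy_class f = htpy_class g <-> homotopic_rel R (@cube_bd k) (val f) (val g).
Proof.
split=> [/eqquotP/asboolP//|fg]; apply/eqquotP/asboolP; exact: fg.
Qed.

Lemma htpy_repr (a : homotopy_group) : htpy_class (repr a) = a.
Proof. exact: reprK. Qed.

End Loops.

Section Coord0.
Variable k : nat.
Implicit Types t : cube R k.+1.

(* t with its first coordinate replaced by a. *)
Definition upd0 t (a : R) : cube R k.+1 :=
  to_cube (fun j => if j == ord0 then a else crd t j).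

Lemma upd0E t a j : crd (upd0 t a) j = if j == ord0 then clamp a else crd t j.
Proof. by rewrite to_cubeE; case: ifP => // _; rewrite clampE // crd_in. Qed.

Lemma upd0_id t : upd0 t (crd t ord0) = t.
Proof.
by apply: cubeP => j; rewrite upd0E; case: eqP => // ->; rewrite clampE // crd_in.
Qed.

Lemma upd0_upd0 t a b : upd0 (upd0 t a) b = upd0 t b.
Proof. by apply: cubeP => j; rewrite !upd0E; case: eqP. Qed.

Lemma upd0_clamp t a : upd0 t (clamp a) = upd0 t a.
Proof.
apply: cubeP => j; rewrite !upd0E; case: eqP => // _.
by rewrite clampE // clamp_in.
Qed.

Lemma upd0_bd t a : clamp a = 0 \/ clamp a = 1 -> cube_bd (upd0 t a).
Proof. by move=> a01; exists ord0; rewrite upd0E eqxx. Qed.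

Lemma upd0_bd0 t a : a <= 0 -> cube_bd (upd0 t a).
Proof.
move=> a0; apply: upd0_bd; left; rewrite /clamp min_r ?max_l //.
exact: le_trans a0 ler01.
Qed.

Lemma upd0_bd1 t a : 1 <= a -> cube_bd (upd0 t a).
Proof.
by move=> a0; apply: upd0_bd; right; rewrite /clamp min_l // max_r.
Qed.

Lemma upd0_bdN t a j : j != ord0 -> crd t j = 0 \/ crd t j = 1 ->
  cube_bd (upd0 t a).
Proof. by move=> j0 tj; exists j; rewrite upd0E (negbTE j0). Qed.

Lemma cube_bdP t (P : Prop) : (crd t ord0 = 0 -> P) -> (crd t ord0 = 1 -> P) ->
  ((forall a, cube_bd (upd0 t a)) -> P) -> cube_bd t -> P.
Proof.
move=> P0 P1 PN [j tj]; have [j0|j0] := eqVneq j ord0.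
  by move: tj; rewrite j0 => -[/P0|/P1].
by apply: PN => a; apply: upd0_bdN j0 tj.
Qed.

Lemma upd0_continuous (T : topologicalType) (t : T -> cube R k.+1) (a : T -> R) :
  continuous t -> continuous a -> continuous (fun x => upd0 (t x) (a x)).
Proof.
move=> ct ca; apply: to_cube_continuous => j.
case: (j == ord0) => //; exact: cts_comp ct (@crd_continuous _ _ j).
Qed.

End Coord0.

Section Group.
Variables (X : topologicalType) (x0 : X) (k : nat).
Local Notation lp := (loop x0 k.+1).
Implicit Types (t : cube R k.+1) (f g h : lp).

Definition concat_fun f g t : X :=
  if crd t ord0 <= 2^-1 then val f (upd0 t (2 * crd t ord0))
  else val g (upd0 t (2 * crd t ord0 - 1)).

Lemma concat_continuous f g : continuous (concat_fun f g).
Proof.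
have c0 := @crd_continuous R k.+1 ord0.
apply: continuous_paste (c0) _ _ _.
- apply: cts_comp (@cts_fun _ _ (val f)).
  exact: upd0_continuous (@cts_idfun _) (ctsM (ctsC 2) c0).
- apply: cts_comp (@cts_fun _ _ (val g)).
  exact: upd0_continuous (@cts_idfun _) (ctsD (ctsM (ctsC 2) c0) (ctsC (-1))).
- move=> t ->; rewrite !loopP //; [apply: upd0_bd0|apply: upd0_bd1]; lra.
Qed.

Lemma concat_bd f g t : cube_bd t -> concat_fun f g t = x0.
Proof.
rewrite /concat_fun => bt; case: ifPn; rewrite -?ltNge => t2; apply: loopP;
  move: bt; apply: cube_bdP => [t0|t0|]; try exact.
- by apply: upd0_bd0; lra.
- by lra.
- by apply: upd0_bd1; lra.
- by apply: upd0_bd1; lra.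
Qed.

Definition concat f g : lp := mkloop (@concat_continuous f g) (@concat_bd f g).

Lemma rev_continuous f : continuous (fun t => val f (upd0 t (1 - crd t ord0))).
Proof.
apply: cts_comp (@cts_fun _ _ (val f)).
apply: upd0_continuous (@cts_idfun _) _.
exact: ctsD (ctsC 1) (ctsN (@crd_continuous R k.+1 ord0)).
Qed.

Lemma rev_bd f t : cube_bd t -> val f (upd0 t (1 - crd t ord0)) = x0.
Proof.
move=> bt; apply: loopP; move: bt; apply: cube_bdP => [t0|t0|]; try exact.
- by apply: upd0_bd1; lra.
- by apply: upd0_bd0; lra.
Qed.

Definition rev_loop f : lp := mkloop (@rev_continuous f) (@rev_bd f).

Definition cst_loop : lp :=
  @mkloop X x0 k.+1 (fun=> x0) (@cts_fun _ _ (cst x0)) (fun _ _ => erefl).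

Lemma loop_clamp f t a b : clamp a = clamp b -> val f (upd0 t a) = val f (upd0 t b).
Proof. by move=> ab; rewrite -upd0_clamp ab upd0_clamp. Qed.

Lemma reparam f g h (r : R * R -> R) :
  continuous r ->
  (forall s, 0 <= s <= 1 -> clamp (r (0, s)) = 0 \/ clamp (r (0, s)) = 1) ->
  (forall s, 0 <= s <= 1 -> clamp (r (1, s)) = 0 \/ clamp (r (1, s)) = 1) ->
  (forall t, val g t = val f (upd0 t (r (crd t ord0, 0)))) ->
  (forall t, val h t = val f (upd0 t (r (crd t ord0, 1)))) ->
  htpy_class g = htpy_class h.
Proof.
move=> cr r0 r1 gE hE; apply/htpy_classP.
apply: (@homotopic_relI _ _ _ _ _ _ (fun p => val f (upd0 p.1 (r (crd p.1 ord0, p.2))))).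
- apply: cts_comp (@cts_fun _ _ (val f)).
  apply: upd0_continuous (@cts_fst _ _) _.
  apply: cts_comp2 (@cts_snd _ _) cr.
  exact: cts_comp (@cts_fst _ _) (@crd_continuous R k.+1 ord0).
- by move=> t; rewrite gE.
- by move=> t; rewrite hE.
- move=> t s s01 bt; rewrite (loopP g bt); apply: loopP.
  move: bt; apply: cube_bdP => [->|->|]; last exact.
    by apply: upd0_bd; exact: r0.
  by apply: upd0_bd; exact: r1.
Qed.

Lemma concat_class f f' g g' : htpy_class f = htpy_class f' ->
  htpy_class g = htpy_class g' -> htpy_class (concat f g) = htpy_class (concat f' g').
Proof.
move=> /htpy_classP/homotopic_rel_ext[H [cH H0 H1 HA]].
move=> /htpy_classP/homotopic_rel_ext[G [cG G0 G1 GA]].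
have c0 : continuous (fun p : cube R k.+1 * R => crd p.1 ord0).
  exact: cts_comp (@cts_fst _ _) (@crd_continuous R k.+1 ord0).
apply/htpy_classP.
apply: (@homotopic_relI _ _ _ _ _ _ (fun p =>
  if crd p.1 ord0 <= 2^-1 then H (upd0 p.1 (2 * crd p.1 ord0), p.2)
  else G (upd0 p.1 (2 * crd p.1 ord0 - 1), p.2))).
- apply: continuous_paste (c0) _ _ _.
  + apply: cts_comp2 _ (@cts_snd _ _) cH.
    exact: upd0_continuous (@cts_fst _ _) (ctsM (ctsC 2) c0).
  + apply: cts_comp2 _ (@cts_snd _ _) cG.
    exact: upd0_continuous (@cts_fst _ _) (ctsD (ctsM (ctsC 2) c0) (ctsC (-1))).
  + move=> p t2; have b1 : cube_bd (upd0 p.1 (2 * crd p.1 ord0)).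
      by apply: upd0_bd1; rewrite t2; lra.
    have b2 : cube_bd (upd0 p.1 (2 * crd p.1 ord0 - 1)).
      by apply: upd0_bd0; rewrite t2; lra.
    by rewrite HA // GA // !loopP.
- by move=> t /=; rewrite H0 G0.
- by move=> t /=; rewrite H1 G1.
- move=> t s _ bt; rewrite (loopP (concat f g) bt) /=.
  case: ifPn; rewrite -?ltNge => t2; rewrite ?HA ?GA ?loopP //;
    move: bt; apply: cube_bdP => [t0|t0|]; try exact.
  all: try (by apply: upd0_bd0; lra).
  all: try (by apply: upd0_bd1; lra).
  all: lra.
Qed.

Lemma rev_class f f' : htpy_class f = htpy_class f' ->
  htpy_class (rev_loop f) = htpy_class (rev_loop f').
Proof.
move=> /htpy_classP/homotopic_rel_ext[H [cH H0 H1 HA]]; apply/htpy_classP.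
apply: (@homotopic_relI _ _ _ _ _ _ (fun p => H (upd0 p.1 (1 - crd p.1 ord0), p.2))).
- apply: cts_comp2 _ (@cts_snd _ _) cH; apply: upd0_continuous (@cts_fst _ _) _.
  apply: ctsD (ctsC 1) (ctsN _).
  exact: cts_comp (@cts_fst _ _) (@crd_continuous R k.+1 ord0).
- by move=> t; rewrite H0.
- by move=> t; rewrite H1.
- move=> t s _ bt; rewrite (loopP (rev_loop f) bt) /=.
  rewrite HA ?loopP //; move: bt; apply: cube_bdP => [t0|t0|]; try exact.
  all: try (by apply: upd0_bd0; lra).
  all: try (by apply: upd0_bd1; lra).
Qed.

Lemma clamp0 (a : R) : a <= 0 -> clamp a = 0.
Proof. by move=> a0; rewrite /clamp min_r ?max_l //; exact: le_trans a0 ler01. Qed.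

Lemma clamp1 (a : R) : 1 <= a -> clamp a = 1.
Proof. by move=> a1; rewrite /clamp min_l // max_r. Qed.

Lemma concatE f g t : val (concat f g) t = concat_fun f g t.
Proof. by []. Qed.

Lemma revE f t : val (rev_loop f) t = val f (upd0 t (1 - crd t ord0)).
Proof. by []. Qed.

Lemma valupd_bd0 f t a : a <= 0 -> val f (upd0 t a) = x0.
Proof. by move=> a0; apply/loopP/upd0_bd0. Qed.

Lemma valupd_bd1 f t a : 1 <= a -> val f (upd0 t a) = x0.
Proof. by move=> a0; apply/loopP/upd0_bd1. Qed.

Lemma concat_cst_r f : htpy_class (concat f cst_loop) = htpy_class f.
Proof.
pose r (p : R * R) : R := (1 - p.2) * Num.min (2 * p.1) 1 + p.2 * p.1.
have cr : continuous r.
  apply: ctsD (ctsM (ctsD (ctsC 1) (ctsN (@cts_snd _ _))) (ctsmin _ (ctsC 1))) _.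
    exact: ctsM (ctsC 2) (@cts_fst _ _).
  exact: ctsM (@cts_snd _ _) (@cts_fst _ _).
apply: (@reparam f _ _ r cr).
- by move=> s _; left; apply: clamp0; rewrite /r /=; case: (leP (2 * 0) (1 : R)) => h; lra.
- by move=> s _; right; apply: clamp1; rewrite /r /=; case: (leP (2 * 1) (1 : R)) => h; lra.
- move=> t; rewrite concatE /concat_fun /r /= subr0 mul1r mul0r addr0.
  case: ifPn; rewrite -?ltNge => t2; first by rewrite min_l //; lra.
  by rewrite min_r ?valupd_bd1 //; lra.
- move=> t; rewrite /r /= subrr mul0r add0r mul1r.
  by rewrite upd0_id.
Qed.

Lemma concat_cst_l f : htpy_class (concat cst_loop f) = htpy_class f.
Proof.
pose r (p : R * R) : R := (1 - p.2) * Num.max (2 * p.1 - 1) 0 + p.2 * p.1.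
have cr : continuous r.
  apply: ctsD (ctsM (ctsD (ctsC 1) (ctsN (@cts_snd _ _))) (ctsmax _ (ctsC 0))) _.
    exact: ctsD (ctsM (ctsC 2) (@cts_fst _ _)) (ctsC (-1)).
  exact: ctsM (@cts_snd _ _) (@cts_fst _ _).
apply: (@reparam f _ _ r cr).
- by move=> s _; left; apply: clamp0; rewrite /r /=; case: (leP (2 * 0 - 1) (0 : R)) => h; lra.
- by move=> s _; right; apply: clamp1; rewrite /r /=; case: (leP (2 * 1 - 1) (0 : R)) => h; lra.
- move=> t; rewrite concatE /concat_fun /r /= subr0 mul1r mul0r addr0.
  case: ifPn; rewrite -?ltNge => t2; last by rewrite max_l //; lra.
  by rewrite max_r ?valupd_bd0 //; lra.
- move=> t; rewrite /r /= subrr mul0r add0r mul1r.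
  by rewrite upd0_id.
Qed.

Lemma concat_rev_r f : htpy_class (concat f (rev_loop f)) = htpy_class cst_loop.
Proof.
pose r (p : R * R) : R := (1 - p.2) * Num.min (2 * p.1) (2 - 2 * p.1).
have cr : continuous r.
  apply: ctsM (ctsD (ctsC 1) (ctsN (@cts_snd _ _))) (ctsmin _ _).
    exact: ctsM (ctsC 2) (@cts_fst _ _).
  exact: ctsD (ctsC 2) (ctsN (ctsM (ctsC 2) (@cts_fst _ _))).
apply: (@reparam f _ _ r cr).
- move=> s _; left; apply: clamp0; rewrite /r /= mulr0 min_l ?mulr0 //; lra.
- move=> s _; left; apply: clamp0; rewrite /r /= mulr1 subrr min_r ?mulr0 //.
- move=> t; rewrite concatE /concat_fun /r /= subr0 mul1r.
  case: ifPn; rewrite -?ltNge => t2; first by rewrite min_l //; lra.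
  rewrite revE upd0_upd0 upd0E eqxx min_r; last by lra.
  rewrite clampE; last by have /andP[] := crd_in t ord0; lra.
  by congr (val f (upd0 _ _)); ring.
- by move=> t; rewrite /r /= subrr mul0r valupd_bd0.
Qed.

Lemma concat_rev_l f : htpy_class (concat (rev_loop f) f) = htpy_class cst_loop.
Proof.
pose r (p : R * R) : R := 1 - (1 - p.2) * Num.min (2 * p.1) (2 - 2 * p.1).
have cr : continuous r.
  apply: ctsD (ctsC 1) (ctsN (ctsM (ctsD (ctsC 1) (ctsN (@cts_snd _ _))) (ctsmin _ _))).
    exact: ctsM (ctsC 2) (@cts_fst _ _).
  exact: ctsD (ctsC 2) (ctsN (ctsM (ctsC 2) (@cts_fst _ _))).
apply: (@reparam f _ _ r cr).
- by move=> s _; right; apply: clamp1; rewrite /r /= mulr0 min_l ?mulr0 ?subr0 //; lra.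
- by move=> s _; right; apply: clamp1; rewrite /r /= mulr1 subrr min_r ?mulr0 ?subr0.
- move=> t; rewrite concatE /concat_fun /r /= subr0 mul1r.
  case: ifPn; rewrite -?ltNge => t2.
    rewrite revE upd0_upd0 upd0E eqxx min_l; last by lra.
    by rewrite clampE //; have /andP[] := crd_in t ord0; lra.
  by rewrite min_r; [congr (val f (upd0 _ _)); ring|lra].
- by move=> t; rewrite /r /= subrr mul0r subr0 valupd_bd1.
Qed.

Lemma concatA f g h :
  htpy_class (concat f (concat g h)) = htpy_class (concat (concat f g) h).
Proof.
pose phi (a : R) : R := Num.min (2 * a) (Num.min (a + 4^-1) ((a + 1) / 2)).
pose r (p : R * R) : R := (1 - p.2) * p.1 + p.2 * phi p.1.
have cr : continuous r.
  apply: ctsD (ctsM (ctsD (ctsC 1) (ctsN (@cts_snd _ _))) (@cts_fst _ _)) _.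
  apply: ctsM (@cts_snd _ _) (ctsmin _ (ctsmin _ _)).
  - exact: ctsM (ctsC 2) (@cts_fst _ _).
  - exact: ctsD (@cts_fst _ _) (ctsC _).
  - exact: ctsM (ctsD (@cts_fst _ _) (ctsC _)) (ctsC _).
apply: (@reparam (concat f (concat g h)) _ _ r cr).
- move=> s _; left; apply: clamp0; rewrite /r /phi /= mulr0 add0r min_l ?mulr0 ?addr0 //.
  by rewrite le_min; apply/andP; split; lra.
- move=> s _; right; apply: clamp1; rewrite /r /phi /= min_r; last first.
    by rewrite ge_min; apply/orP; right; lra.
  by rewrite min_r; lra.
- by move=> t; rewrite /r /= subr0 mul1r mul0r addr0 upd0_id.
- move=> t; rewrite /r /= subrr mul0r add0r mul1r.
  have /andP[t0 t1] := crd_in t ord0; set a := crd t ord0 in t0 t1 *.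
  rewrite !concatE /concat_fun !upd0E eqxx -/a.
  have ph01 : 0 <= phi a <= 1.
    rewrite /phi !le_min !ge_min; apply/andP; split; [|by apply/orP; right; apply/orP; right; lra].
    by apply/andP; split; [lra|apply/andP; split; lra].
  rewrite (clampE ph01) !upd0_upd0.
  case: ifPn; rewrite -?ltNge => a2.
    rewrite concatE /concat_fun !upd0E eqxx clampE; last by lra.
    rewrite !upd0_upd0; case: ifPn; rewrite -?ltNge => a4.
      have -> : phi a = 2 * a.
        by rewrite /phi min_l // le_min; apply/andP; split; lra.
      by rewrite ifT //; lra.
    have -> : phi a = a + 4^-1.
      by rewrite /phi [X in Num.min _ X]min_l ?min_r //; lra.
    rewrite ifF; last by apply/negbTE; rewrite -ltNge; lra.
    rewrite concatE /concat_fun !upd0E eqxx clampE; last by lra.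
    rewrite ifT; last by lra.
    by rewrite !upd0_upd0; congr (val g (upd0 _ _)); field.
  have -> : phi a = (a + 1) / 2.
    by rewrite /phi [X in Num.min _ X]min_r ?min_r //; lra.
  rewrite ifF; last by apply/negbTE; rewrite -ltNge; lra.
  rewrite concatE /concat_fun !upd0E eqxx clampE; last by lra.
  rewrite ifF; last by apply/negbTE; rewrite -ltNge; lra.
  by rewrite !upd0_upd0; congr (val h (upd0 _ _)); field.
Qed.

Local Notation G := (homotopy_group x0 k.+1).

Definition htpy_mul (a b : G) : G := htpy_class (concat (repr a) (repr b)).
Definition htpy_inv (a : G) : G := htpy_class (rev_loop (repr a)).
Definition htpy_one : G := htpy_class cst_loop.

Lemma htpy_mulE f g :
  htpy_mul (htpy_class f) (htpy_class g) = htpy_class (concat f g).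
Proof. by apply: concat_class; rewrite htpy_repr. Qed.

Lemma htpy_invE f : htpy_inv (htpy_class f) = htpy_class (rev_loop f).
Proof. by apply: rev_class; rewrite htpy_repr. Qed.

Lemma htpy_mulA : associative htpy_mul.
Proof.
move=> a b c; rewrite -[a]htpy_repr -[b]htpy_repr -[c]htpy_repr !htpy_mulE.
exact: concatA.
Qed.

Lemma htpy_mul1 : left_id htpy_one htpy_mul.
Proof. by move=> a; rewrite -[a]htpy_repr htpy_mulE concat_cst_l. Qed.

Lemma htpy_mulr1 : right_id htpy_one htpy_mul.
Proof. by move=> a; rewrite -[a]htpy_repr htpy_mulE concat_cst_r. Qed.

Lemma htpy_mulV : left_inverse htpy_one htpy_inv htpy_mul.
Proof. by move=> a; rewrite -[a]htpy_repr htpy_invE htpy_mulE concat_rev_l. Qed.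

Lemma htpy_mulrV : right_inverse htpy_one htpy_inv htpy_mul.
Proof. by move=> a; rewrite -[a]htpy_repr htpy_invE htpy_mulE concat_rev_r. Qed.

HB.instance Definition _ := isGroup.Build G
  htpy_mulA htpy_mul1 htpy_mulr1 htpy_mulV htpy_mulrV.

End Group.
End HomotopyGroup.

(* Singular homology is taken in its cubical form: a singular k-cube of X is a
   continuous map I^k -> X, and degenerate cubes are divided out. *)
Section Homology.
Context (R : realType).

(* The face t_i = e of I^(k+1). *)
Definition face_fun (k : nat) (i : 'I_k.+1) (e : bool) (t : cube R k) :
  cube R k.+1 :=
  to_cube (fun j => if unlift i j is Some j' then crd t j' else e%:R).

Lemma face_continuous k (i : 'I_k.+1) e : continuous (face_fun i e).
Proof.
apply: to_cube_continuous => j; case: unliftP => [j' _|_]; last exact: ctsC.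
exact: crd_continuous.
Qed.

Definition face (k : nat) (i : 'I_k.+1) (e : bool) :
  continuousType (cube R k) (cube R k.+1) := cmap (@face_continuous k i e).

Section Chains.
Variable (X : topologicalType).

Definition chain (k : nat) := {freeg (continuousType (cube R k) X) / int}.

Definition bdry (k : nat) : chain k.+1 -> chain k :=
  fglift (fun c : continuousType (cube R k.+1) X =>
    \sum_(i < k.+1) (-1) ^+ i *:
      (<< ccomp c (face i true) >> - << ccomp c (face i false) >> : chain k)).

Lemma bdry_is_additive k : zmod_morphism (@bdry k).
Proof. exact: lift_is_additive. Qed.

HB.instance Definition _ k :=
  GRing.isZmodMorphism.Build (chain k.+1) (chain k) (@bdry k) (@bdry_is_additive k).

(* c does not depend on one of its coordinates. *)
Definition degenerate k (c : cube R k -> X) :=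
  exists i, forall t u, (forall j, j != i -> crd t j = crd u j) -> c t = c u.

Section Relative.
Variables (A : set X) (k : nat).

(* The chains spanned by the degenerate cubes and the cubes lying in A. *)
Definition negligible : {pred chain k} := fun x =>
  `[< forall c, c \in dom x -> degenerate c \/ (forall t, A (c t)) >].

Lemma negligible_zmod_closed : zmod_closed negligible.
Proof.
split=> [|x y]; rewrite !unfold_in /negligible.
  by apply/asboolP => c; rewrite dom0.
move=> /asboolP xA /asboolP yA; apply/asboolP => c /domB.
by rewrite mem_cat => /orP[/xA|/yA].
Qed.
HB.instance Definition _ := GRing.isZmodClosed.Build (chain k) negligible
  negligible_zmod_closed.
End Relative.
End Chains.
End Homology.
Arguments negligible {R X} A {k}.
Arguments face {R k} i e.

Section HomologyGroup.
Context (R : realType) (X : topologicalType) (A : set X) (k : nat).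

Definition cycles : {pred chain R X k} :=
  match k return {pred chain R X k} with
  | 0 => predT
  | k'.+1 => fun x => bdry x \in negligible A
  end.

Lemma cycles_zmod_closed : zmod_closed cycles.
Proof.
rewrite /cycles; case: k => [|k']; first by [].
pose S : {pred chain R X k'.+1} := fun x => bdry x \in negligible A.
have SE x : (x \in S) = (bdry x \in negligible A) by rewrite [LHS]unfold_in.
rewrite -/S; split=> [|x y]; rewrite !SE.
  by rewrite raddf0 rpred0.
by move=> xA yA; rewrite raddfB rpredB.
Qed.
HB.instance Definition _ :=
  GRing.isZmodClosed.Build (chain R X k) cycles cycles_zmod_closed.

Record cycle := Cycle { cycle_val : chain R X k; _ : cycles cycle_val }.

HB.instance Definition _ := [isSub for cycle_val].
HB.instance Definition _ := [Choice of cycle by <:].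
HB.instance Definition _ := [SubChoice_isSubZmodule of cycle by <:].

Definition boundaries : {pred cycle} :=
  fun z => `[< exists y : chain R X k.+1, val z - bdry y \in negligible A >].

Lemma boundaries_zmod_closed : zmod_closed boundaries.
Proof.
split=> [|x y /asboolP[u xu] /asboolP[v yv]]; apply/asboolP.
  by exists 0; rewrite !raddf0 addr0 rpred0.
exists (u - v); rewrite (raddfB (@bdry R X k)) raddfB [X in X \in _](_ : _ = (val x - bdry u) - (val y - bdry v)).
  exact: rpredB.
by rewrite !opprD addrACA.
Qed.
HB.instance Definition _ :=
  GRing.isZmodClosed.Build cycle boundaries boundaries_zmod_closed.

(* H_k(X, A) with integer coefficients; H_k(X) is the case A = set0. *)
Definition homology : zmodType := Quotient.quot boundaries.

Definition homology_class (z : cycle) : homology := \pi_(Quotient.quot boundaries) z.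

End HomologyGroup.

Arguments loop_set R {X} x0 k.
Arguments homology R {X} A k.
Arguments cycle R {X} A k.

Section Induced.
Context (R : realType).

Lemma loop_map_subproof (X Y : topologicalType) (x0 : X) (y0 : Y)
    (f : continuousType X Y) (fx : f x0 = y0) k (l : loop R x0 k) :
  loop_set R y0 k (ccomp f (val l)).
Proof. by move=> t bt; rewrite /ccomp /= loopP. Qed.

Definition loop_map (X Y : topologicalType) (x0 : X) (y0 : Y)
    (f : continuousType X Y) (fx : f x0 = y0) k (l : loop R x0 k) : loop R y0 k :=
  exist _ (ccomp f (val l)) (mem_set (loop_map_subproof fx l)).

Definition htpy_map (X Y : topologicalType) (x0 : X) (y0 : Y)
    (f : continuousType X Y) (fx : f x0 = y0) k (a : homotopy_group R x0 k) :
  homotopy_group R y0 k := htpy_class (loop_map fx (repr a)).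

End Induced.

Section Hurewicz.
Context (R : realType) (X : topologicalType).

Lemma negligible_sub (A B : set X) k (x : chain R X k) : A `<=` B ->
  x \in negligible A -> x \in negligible B.
Proof.
move=> AB /asboolP xA; apply/asboolP => c /xA[|cA]; first by left.
by right=> t; apply: AB.
Qed.

Lemma cycles_sub (A : set X) k (x : chain R X k) : cycles set0 x -> cycles A x.
Proof. by case: k x => [|k] x //=; exact: negligible_sub. Qed.

(* The map H_k(X) -> H_k(X, A). *)
Definition homology_rel (A : set X) k (z : homology R (set0 : set X) k) :
    homology R A k :=
  homology_class (Cycle (@cycles_sub A k _ (valP (repr z)))).

Lemma bdryU k (c : continuousType (cube R k.+1) X) :
  bdry << c >> = \sum_(i < k.+1) (-1) ^+ i *:
    (<< ccomp c (face i true) >> - << ccomp c (face i false) >> : chain R X k).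
Proof. by rewrite /bdry liftU scale1r. Qed.

Lemma face_crd k (i : 'I_k.+1) e (t : cube R k) : crd (face i e t) i = e%:R.
Proof.
rewrite /= /face_fun to_cubeE unlift_none clampE //.
by case: e; rewrite ?lexx ?ler01.
Qed.

Lemma face_crd_lift k (i : 'I_k.+1) e (t : cube R k) j :
  crd (face i e t) (fintype.lift i j) = crd t j.
Proof. by rewrite /= /face_fun to_cubeE liftK clampE // crd_in. Qed.

Lemma loop_cycle (x0 : X) k (l : loop R x0 k) : cycles set0 (<< val l >>).
Proof.
case: k l => // k l; rewrite /cycles bdryU big1 ?rpred0 // => i _.
rewrite (_ : ccomp _ _ = ccomp (val l) (face i false)) ?subrr ?scaler0 //.
by apply/continuousEP => t; rewrite /ccomp /= !loopP //; exists i;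
  rewrite face_crd; [left|right].
Qed.

(* A loop I^k -> X is itself a singular cube, and a cycle. *)
Definition hurewicz (x0 : X) k (a : homotopy_group R x0 k) :
    homology R (set0 : set X) k :=
  homology_class (Cycle (loop_cycle (repr a))).

Section RelativeLoops.
Variables (A : set X) (a0 : A) (k : nat).

(* Maps (I^(k+1), boundary, J) -> (X, A, a0) representing the elements of the
   relative homotopy group pi_(k+1)(X, A, a0); the face t_k = 0 (last coordinate)
   goes to A and J is the union of the other faces. *)
Definition rel_loop_set : set (continuousType (cube R k.+1) X) :=
  [set f | (forall t, crd t ord_max = 0 -> A (f t)) /\
    (forall t, crd t ord_max = 1 \/
       (exists2 i, i != ord_max & crd t i = 0 \/ crd t i = 1) -> f t = val a0)].

Arguments rel_loop_set : clear implicits.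
Definition rel_loop : Type := rel_loop_set.

Lemma rel_loop_cycle (l : rel_loop) : cycles A (<< val l >>).
Proof.
have [lA lJ] := set_mem (valP l).
rewrite /cycles bdryU; apply: rpred_sum => i _.
have Aface e : << ccomp (val l) (face i e) >> \in negligible A.
  apply/asboolP => c; rewrite domU1 inE => /eqP ->; right=> t; rewrite /ccomp /=.
  have [im|im] := eqVneq i ord_max; last first.
    rewrite lJ; first exact: (set_mem (valP a0)).
    by right; exists i => //; rewrite face_crd; case: e; [right|left].
  case: e; last by apply: lA; rewrite -im face_crd.
  by rewrite lJ; [exact: (set_mem (valP a0))|left; rewrite -im face_crd].
by rewrite -signr_odd; case: odd; rewrite ?expr1 ?expr0 ?scaleN1r ?scale1r ?rpredN rpredB.
Qed.

Definition rel_hurewicz (l : rel_loop) : homology R A k.+1 :=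
  homology_class (Cycle (rel_loop_cycle l)).

Lemma rel_bdry_subproof (l : rel_loop) t : val l (face ord_max false t) \in A.
Proof. by apply/mem_set/(set_mem (valP l)).1; rewrite face_crd. Qed.

Definition rel_bdry_fun (l : rel_loop) (t : cube R k) : A :=
  exist _ (val l (face ord_max false t)) (rel_bdry_subproof l t).

Lemma rel_bdry_continuous (l : rel_loop) : continuous (rel_bdry_fun l).
Proof.
apply: continuous_comp_initial.
exact: cts_comp (@cts_fun _ _ (face ord_max false)) (@cts_fun _ _ (val l)).
Qed.

Lemma rel_bdry_bd (l : rel_loop) t : cube_bd t -> rel_bdry_fun l t = a0.
Proof.
move=> [i ti]; apply: val_inj; apply: (set_mem (valP l)).2; right.
exists (fintype.lift ord_max i); first by rewrite eq_sym neq_lift.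
by rewrite face_crd_lift.
Qed.

(* The boundary pi_(k+1)(X, A, a0) -> pi_k(A, a0) on representatives. *)
Definition rel_bdry (l : rel_loop) : homotopy_group R a0 k :=
  htpy_class (mkloop (@rel_bdry_continuous l) (@rel_bdry_bd l)).

End RelativeLoops.
End Hurewicz.

Section Hopf.
Context (R : realType).

Definition sphere (k : nat) : topologicalType :=
  [set x : 'rV[R]_k.+1 | \sum_i x ord0 i ^+ 2 = 1].

(* The map I^k -> S^k that collapses the boundary to the pole (0,...,0,1) and is a
   homeomorphism elsewhere: with x = 2t - 1 and d = prod_i (1 - x_i^2), it is
   t |-> x / d followed by inverse stereographic projection. *)
Section Collapse.
Variables (k : nat) (t : cube R k).

Let x (i : 'I_k) : R := 2 * crd t i - 1.
Let d : R := \prod_i (4 * crd t i * (1 - crd t i)).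
Let s : R := \sum_i x i ^+ 2.

Definition collapse_vec : 'rV[R]_k.+1 :=
  \row_j ((if unlift ord_max j is Some i then 2 * d * x i else s - d ^+ 2)
            / (s + d ^+ 2)).

Lemma collapse_sphere : \sum_i collapse_vec ord0 i ^+ 2 = 1.
Proof.
have s0 : 0 <= s by apply: sumr_ge0 => i _; exact: sqr_ge0.
have sd : s + d ^+ 2 != 0.
  apply/negP; rewrite paddr_eq0 ?sqr_ge0 // => /andP[/eqP s00 /eqP/eqP].
  rewrite sqrf_eq0 => /prodf_eq0[i _ ti].
  have /eqP := s00; rewrite psumr_eq0; last by move=> ? _; exact: sqr_ge0.
  move=> /allP/(_ i); rewrite mem_index_enum => /(_ isT); rewrite /= sqrf_eq0 /x.
  move: ti; rewrite !mulf_eq0 => /orP[/orP[]|] /eqP h /eqP h2; lra.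
rewrite (bigD1_ord ord_max) //= mxE unlift_none.
rewrite (eq_bigr (fun i => (2 * d / (s + d ^+ 2)) ^+ 2 * x i ^+ 2)); last first.
  by move=> i _; rewrite mxE liftK; ring.
by rewrite -mulr_sumr -/s; field.
Qed.

Definition collapse : sphere k := exist _ collapse_vec (mem_set collapse_sphere).

End Collapse.

(* On R^4 x R^(k-2), (v, u) |-> (H(v) / |v|, u) with the Hopf map
   H(z, w) = (|z|^2 - |w|^2, 2 z conj(w)), z = v_0 + i v_1, w = v_2 + i v_3.  On unit
   spheres this is the (k-2)-fold suspension S^(k+1) -> S^k of H : S^3 -> S^2. *)
Definition hopf_vec (k : nat) (x : 'rV[R]_k.+2) : 'rV[R]_k.+1 :=
  let v a := x ord0 (inord a) in
  let r := Num.sqrt (v 0%N ^+ 2 + v 1%N ^+ 2 + v 2%N ^+ 2 + v 3%N ^+ 2) in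
  \row_j match val j with
  | 0 => (v 0%N ^+ 2 + v 1%N ^+ 2 - v 2%N ^+ 2 - v 3%N ^+ 2) / r
  | 1 => 2 * (v 0%N * v 2%N + v 1%N * v 3%N) / r
  | 2 => 2 * (v 1%N * v 2%N - v 0%N * v 3%N) / r
  | j.+3 => v j.+4
  end.

Lemma hopf_sphere (k : nat) (x : 'rV[R]_k.+2) : (2 <= k)%N ->
  \sum_i x ord0 i ^+ 2 = 1 -> \sum_i hopf_vec x ord0 i ^+ 2 = 1.
Proof.
case: k x => [|[|k]] x //= _ <-; rewrite /hopf_vec.
rewrite !big_ord_recl !mxE /=.
set v := fun a => x ord0 (inord a).
have vE (i : 'I_k.+4) : x ord0 i = v i by rewrite /v inord_val.
rewrite (eq_bigr (fun i : 'I_k => v i.+4 ^+ 2)); last by move=> i _; rewrite mxE /=.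
rewrite [in RHS](eq_bigr (fun i : 'I_k => v i.+4 ^+ 2)); last by move=> i _; rewrite vE.
rewrite !vE /bump /= !inordK //.
set q := v 0%N ^+ 2 + v 1%N ^+ 2 + v 2%N ^+ 2 + v 3%N ^+ 2.
have q0 : 0 <= q by rewrite !addr_ge0 // sqr_ge0.
have := sqr_sqrtr q0; set r := Num.sqrt q => rq.
set w := \sum_(i < k) _.
have E : ((v 0%N ^+ 2 + v 1%N ^+ 2 - v 2%N ^+ 2 - v 3%N ^+ 2) / r) ^+ 2 +
    (2 * (v 0%N * v 2%N + v 1%N * v 3%N) / r) ^+ 2 +
    (2 * (v 1%N * v 2%N - v 0%N * v 3%N) / r) ^+ 2 = q.
  have [r0|r0] := eqVneq r 0.
    by rewrite r0 invr0 !mulr0 expr0n /= !addr0 -rq r0 expr0n.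
  apply: (mulIf (expf_neq0 2 r0)); rewrite [in RHS]rq.
  rewrite (_ : _ * r ^+ 2 = (v 0%N ^+ 2 + v 1%N ^+ 2 - v 2%N ^+ 2 - v 3%N ^+ 2) ^+ 2 +
    (2 * (v 0%N * v 2%N + v 1%N * v 3%N)) ^+ 2 +
    (2 * (v 1%N * v 2%N - v 0%N * v 3%N)) ^+ 2); last by field.
  by rewrite /q; ring.
by rewrite -/r !addrA in E *; rewrite E.
Qed.

Definition pole_vec (k : nat) : 'rV[R]_k.+1 := \row_j (j == ord_max)%:R.

Lemma pole_sphere k : \sum_i pole_vec k ord0 i ^+ 2 = 1.
Proof.
rewrite (bigD1 ord_max) //= mxE eqxx expr1n big1 ?addr0 // => i /negbTE im.
by rewrite mxE im expr0n.
Qed.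

Definition pole (k : nat) : sphere k := exist _ (pole_vec k) (mem_set (@pole_sphere k)).

(* For 2 <= k the default value is never used: see suspended_hopfE. *)
Definition suspended_hopf (k : nat) (x : sphere k.+1) : sphere k :=
  insubd (pole k) (hopf_vec (val x)).

Lemma suspended_hopfE (k : nat) (x : sphere k.+1) : (2 <= k)%N ->
  val (suspended_hopf x) = hopf_vec (val x).
Proof.
move=> k2; rewrite /suspended_hopf val_insubd ifT //.
exact/mem_set/hopf_sphere/(set_mem (valP x)).
Qed.

(* gamma is the composite of beta : S^k -> Y with the suspended Hopf map. *)
Definition hopf_precomp (Y : topologicalType) (y0 : Y) (k : nat)
    (beta : homotopy_group R y0 k) (gamma : homotopy_group R y0 k.+1) : Prop :=
  exists (b : continuousType (sphere k) Y) (l : loop R y0 k) (l' : loop R y0 k.+1),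
  [/\ beta = htpy_class l, gamma = htpy_class l',
      forall t, val l t = b (collapse t) &
      forall t, val l' t = b (suspended_hopf (collapse t))].

End Hopf.

Arguments hurewicz {R X x0 k} a.
Arguments htpy_map {R X Y x0 y0} f fx {k} a.
Arguments sphere R k : clear implicits.

Section Span.
Variables (V : zmodType) (G : V -> Prop).

(* The subgroup generated by G. *)
Definition span : {pred V} := fun x =>
  `[< forall S : {pred V}, zmod_closed S -> (forall y, G y -> y \in S) -> x \in S >].

Lemma span_zmod_closed : zmod_closed span.
Proof.
split=> [|x y /asboolP xS /asboolP yS]; apply/asboolP => S cS GS.
  exact: cS.1.
by apply: cS.2; [exact: xS|exact: yS].
Qed.
HB.instance Definition _ := GRing.isZmodClosed.Build V span span_zmod_closed.
End Span.

Section Tensor.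
Variables A B : zmodType.
Local Notation F := {freeg (A * B)%type / int}.

Definition bilinear_relation (x : F) : Prop :=
  (exists a a' b, x = << (a + a', b) >> - << (a, b) >> - << (a', b) >>) \/
  (exists a b b', x = << (a, b + b') >> - << (a, b) >> - << (a, b') >>).

Definition tensor : zmodType := Quotient.quot (span bilinear_relation).

Definition tens (a : A) (b : B) : tensor :=
  \pi_(Quotient.quot (span bilinear_relation)) (<< (a, b) >> : F).

End Tensor.

(* f (x) id_B, for f additive. *)
Definition tensor_map (A A' B : zmodType) (f : A -> A') (x : tensor A B) :
    tensor A' B :=
  \pi_(Quotient.quot (span (@bilinear_relation A' B)))
    (fglift (fun p : A * B => << (f p.1, p.2) >> : {freeg (A' * B)%type / int})
      (repr x)).

Record aut (A : zmodType) := Aut {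
  aut_fun :> A -> A;
  autD : {morph aut_fun : x y / x + y};
  aut_bij : bijective aut_fun }.

Section AutGroup.
Variable A : zmodType.

HB.instance Definition _ := gen_eqMixin (aut A).
HB.instance Definition _ := gen_choiceMixin (aut A).

Lemma autP (f g : aut A) : f =1 g -> f = g.
Proof.
case: f g => [f fD fb] [g gD gb] /= /funext fg; subst g.
by rewrite (Prop_irrelevance fD gD) (Prop_irrelevance fb gb).
Qed.

Definition aut1 : aut A :=
  @Aut A id (fun _ _ => erefl) (Bijective (fun _ => erefl) (fun _ => erefl)).

Lemma aut_mulD (f g : aut A) : {morph f \o g : x y / x + y}.
Proof. by move=> x y /=; rewrite !autD. Qed.

Definition aut_mul (f g : aut A) : aut A :=
  Aut (@aut_mulD f g) (bij_comp (aut_bij f) (aut_bij g)).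

Lemma aut_inv_ex (f : aut A) : exists g : aut A, cancel f g /\ cancel g f.
Proof.
have [g fg gf] := aut_bij f.
have gD : {morph g : x y / x + y}.
  by move=> x y; apply: (bij_inj (aut_bij f)); rewrite autD !gf.
by exists (Aut gD (Bijective gf fg)).
Qed.

Definition aut_inv (f : aut A) : aut A := projT1 (cid (aut_inv_ex f)).

Lemma aut_mulA : associative aut_mul. Proof. by move=> f g h; exact: autP. Qed.
Lemma aut_mul1 : left_id aut1 aut_mul. Proof. by move=> f; exact: autP. Qed.
Lemma aut_mulr1 : right_id aut1 aut_mul. Proof. by move=> f; exact: autP. Qed.
Lemma aut_mulV : left_inverse aut1 aut_inv aut_mul.
Proof. by move=> f; apply: autP => x /=; rewrite (projT2 (cid (aut_inv_ex f))).1. Qed.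
Lemma aut_mulrV : right_inverse aut1 aut_inv aut_mul.
Proof. by move=> f; apply: autP => x /=; rewrite (projT2 (cid (aut_inv_ex f))).2. Qed.

HB.instance Definition _ :=
  isGroup.Build (aut A) aut_mulA aut_mul1 aut_mulr1 aut_mulV aut_mulrV.
End AutGroup.

Section CW.
Context (R : realType).

(* J. H. C. Whitehead's definition, with the cube I^k as model of the closed
   k-cell: X is Hausdorff and the disjoint union of the open cells; the boundary
   of a k-cell lies in finitely many open cells of lower dimension; X carries the
   weak topology. *)
Record CW_structure (X : topologicalType) := {
  cw_cell : nat -> Type;
  cw_chi : forall k, cw_cell k -> continuousType (cube R k) X;
  cw_hausdorff : hausdorff_space X;
  cw_cover : forall x, exists k (e : cw_cell k) t, ~ cube_bd t /\ cw_chi e t = x;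
  cw_disjoint : forall k (e : cw_cell k) t k' (e' : cw_cell k') t',
    ~ cube_bd t -> ~ cube_bd t' -> cw_chi e t = cw_chi e' t' ->
    existT (fun j => cw_cell j * cube R j)%type k (e, t) = existT _ k' (e', t');
  cw_closure_finite : forall k (e : cw_cell k),
    exists F : set {j : nat & cw_cell j},
    [/\ finite_set F, forall c, F c -> (tag c < k)%N &
        forall t, cube_bd t ->
          exists2 c, F c & exists2 u, ~ cube_bd u & cw_chi e t = cw_chi (tagged c) u];
  cw_weak : forall B : set X,
    (forall k (e : cw_cell k), closed (cw_chi e @^-1` B)) -> closed B }.

Definition skeleton (X : topologicalType) (K : CW_structure X) (m : nat) : set X :=
  [set x | exists k (e : cw_cell K k) t, (k <= m)%N /\ cw_chi e t = x].

(* X is m-connected. *)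
Definition n_connected (X : topologicalType) (m : nat) : Prop :=
  (exists x : X, True) /\
  forall k, (k <= m)%N -> forall (x0 : X) (a b : homotopy_group R x0 k), a = b.

(* An A_n^2-polyhedron: (n-1)-connected and of dimension at most n + 2. *)
Definition A2_polyhedron (n : nat) (X : topologicalType) (K : CW_structure X) : Prop :=
  n_connected X n.-1 /\ forall k, (n.+2 < k)%N -> cw_cell K k -> False.

Definition homotopy_equivalent (X Y : topologicalType) : Prop :=
  exists (f : continuousType X Y) (g : continuousType Y X),
    homotopic_rel R set0 (g \o f) id /\ homotopic_rel R set0 (f \o g) id.

(* Finitely many cells in each dimension, up to homotopy equivalence. *)
Definition finite_type (X : topologicalType) : Prop :=
  exists (Y : topologicalType) (L : CW_structure Y),
    (forall k, finite_set [set: cw_cell L k]) /\ homotopy_equivalent X Y.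

Section Skeleta.
Variables (X : topologicalType) (K : CW_structure X).

Definition skel (m : nat) : topologicalType := skeleton K m.

Lemma skeleton_mono m p : (m <= p)%N -> skeleton K m `<=` skeleton K p.
Proof.
by move=> mp x [k [e [t [km <-]]]]; exists k, e, t; rewrite (leq_trans km mp).
Qed.

Definition skel_val (m : nat) : continuousType (skel m) X :=
  cmap (@initial_continuous (skeleton K m) X set_val).

Definition skel_incl_fun (m : nat) (x : skel m) : skel m.+1 :=
  exist _ (val x) (mem_set (skeleton_mono (leqnSn m) (set_mem (valP x)))).

Lemma skel_incl_continuous m : continuous (@skel_incl_fun m).
Proof. by apply: continuous_comp_initial; exact: initial_continuous. Qed.

Definition skel_incl (m : nat) : continuousType (skel m) (skel m.+1) :=
  cmap (@skel_incl_continuous m).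

Definition skel_pt (x0 : skel 0) (m : nat) : skel m :=
  exist _ (val x0) (mem_set (skeleton_mono (leq0n m) (set_mem (valP x0)))).

Lemma skel_incl_pt (x0 : skel 0) m : skel_incl m (skel_pt x0 m) = skel_pt x0 m.+1.
Proof. exact: val_inj. Qed.

Lemma skel_val_pt (x0 : skel 0) m : skel_val m (skel_pt x0 m) = val x0.
Proof. by []. Qed.

End Skeleta.
End CW.

Arguments rel_loop R {X A} a0 k.
Arguments skel {R X} K m.
Arguments skel_pt {R X K} x0 m.

Section Gamma.
Context (R : realType) (X : topologicalType).

Definition HZ (k : nat) : zmodType := homology R (set0 : set X) k.

Definition Gamma1 (A : zmodType) : zmodType := tensor A 'Z_2.
Definition Gamma1_map (A A' : zmodType) (f : A -> A') : Gamma1 A -> Gamma1 A' :=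
  tensor_map f.

Variables (K : CW_structure R X) (x0 : skel K 0) (n : nat).

Definition pi_X (k : nat) := homotopy_group R (val x0) k.
Definition pi_skel (m k : nat) := homotopy_group R (skel_pt x0 m) k.

Definition to_X (m k : nat) : pi_skel m k -> pi_X k :=
  htpy_map (skel_val K m) (skel_val_pt x0 m).
Definition to_next (m k : nat) : pi_skel m k -> pi_skel m.+1 k :=
  htpy_map (skel_incl K m) (skel_incl_pt x0 m).

(* The final part
     H_(n+2)(X) --b--> H_n(X) (x) Z_2 --i--> pi_(n+1)(X) --h--> H_(n+1)(X) --> 0
   of Whitehead's exact sequence.  Here
   - gs_theta is the identification of H_n(X) (x) Z_2 with
     Gamma_(n+1)(X) = Im(pi_(n+1)(X^n) -> pi_(n+1)(X^(n+1))): it sends h_n(beta) (x) 1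
     to the composite of beta with the suspended Hopf map, for beta in pi_n(X^n);
   - i is gs_theta followed by the map induced by the inclusion of X^(n+1) in X;
   - b is the boundary pi_(n+2)(X, X^(n+1)) -> pi_(n+1)(X^(n+1)) restricted to the
     cellular cycles: as X = X^(n+2), these are the image of H_(n+2)(X) in
     H_(n+2)(X, X^(n+1)), which the relative Hurewicz map identifies with
     pi_(n+2)(X, X^(n+1)). *)
Record Gamma_sequence := {
  gs_theta : Gamma1 (HZ n) -> pi_skel n.+1 n.+1;
  gs_thetaD : forall u v, gs_theta (u + v) = (gs_theta u * gs_theta v)%g;
  gs_theta_inj : injective gs_theta;
  gs_theta_im : range gs_theta = range (@to_next n n.+1);
  gs_theta_hopf : forall (beta : pi_skel n n) (gamma : pi_skel n n.+1),
    hopf_precomp beta gamma ->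
    gs_theta (tens (hurewicz (to_X beta) : HZ n) (1 : 'Z_2)) = to_next gamma;
  gs_b : {additive HZ n.+2 -> Gamma1 (HZ n)};
  gs_b_boundary : forall z : HZ n.+2,
    exists alpha : rel_loop R (skel_pt x0 n.+1) n.+1,
      rel_hurewicz alpha = homology_rel (skeleton K n.+1) z /\
      gs_theta (gs_b z) = rel_bdry alpha;
  gs_exact_Gamma : forall u,
    to_X (gs_theta u) = 1%g <-> exists z, gs_b z = u;
  gs_exact_pi : forall a : pi_X n.+1,
    (hurewicz a : HZ n.+1) = 0 <-> exists u, to_X (gs_theta u) = a;
  gs_exact_H : forall y : HZ n.+1, exists a : pi_X n.+1, hurewicz a = y }.

Definition gs_i (S : Gamma_sequence) (u : Gamma1 (HZ n)) : pi_X n.+1 :=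
  to_X (gs_theta S u).

Variable S : Gamma_sequence.

(* The triples (f_(n+2), f_(n+1), f_n), inside the group
   Aut H_(n+2)(X) x Aut H_(n+1)(X) x Aut H_n(X). *)
Definition Gamma_isos : {pred aut (HZ n.+2) * aut (HZ n.+1) * aut (HZ n)} :=
  fun f => `[< exists Omega : {multiplicative pi_X n.+1 -> pi_X n.+1},
    [/\ forall z, gs_b S (f.1.1 z) = Gamma1_map f.2 (gs_b S z),
        forall u, Omega (gs_i S u) = gs_i S (Gamma1_map f.2 u) &
        forall a, hurewicz (Omega a) = f.1.2 (hurewicz a)] >].
End Gamma.

(* Main.v *)
(* Conjugated to H_n(X) = Z^2 + G, the transvections (a, b, g) |-> (a + 2 m b, b, g)
   form an infinite family of automorphisms of H_n(X).  Each is the identity modulo 2,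
   so it acts trivially on H_n(X) (x) Z_2, and together with the identities of
   H_(n+2)(X), H_(n+1)(X) and Omega = id it is a Gamma-isomorphism.  The
   Gamma-isomorphisms are closed under division because any Omega is bijective by the
   five lemma; this uses that the Hurewicz map is a homomorphism. *)

From HB Require Import structures.
Require Import Defs.
From mathcomp Require Import all_boot all_order all_algebra ring lra zify.
From mathcomp Require Import all_classical all_reals topology normedtype.
From mathcomp Require Import freeg.
Set Implicit Arguments.
Unset Strict Implicit.
Unset Printing Implicit Defensive.
Import Order.TTheory GRing.Theory Num.Theory.
Import numFieldNormedType.Exports.
Local Open Scope classical_set_scope.
Local Open Scope ring_scope.
Local Open Scope quotient_scope.

(** * Tensor products and their reduction modulo 2 *)

HB.instance Definition _ (K : choiceType) (M : lmodType int) (f : K -> M) :=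
  GRing.isZmodMorphism.Build {freeg K / int} M (fglift f) (lift_is_additive f).

Section Tensor.
Variables A A' B : zmodType.

Lemma tens_additivel (a a' : A) (b : B) :
  tens (a + a') b = tens a b + tens a' b.
Proof.
rewrite /tens -raddfD; apply/eqP; rewrite -Quotient.idealrBE.
apply/asboolP => S _; apply; left; exists a, a', b.
by rewrite opprD addrA.
Qed.

Lemma tens_additiver (a : A) (b b' : B) :
  tens a (b + b') = tens a b + tens a b'.
Proof.
rewrite /tens -raddfD; apply/eqP; rewrite -Quotient.idealrBE.
apply/asboolP => S _; apply; right; exists a, b, b'.
by rewrite opprD addrA.
Qed.

Local Notation lift f := (fglift
  (fun p : A * B => << (f p.1, p.2) >> : {freeg (A' * B)%type / int})).

(** Independence of the representative chosen by [tensor_map]: the elements whose lift is a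
    consequence of the target relations form a subgroup, and it contains the bilinear relations
    because [f] is additive. *)
Lemma tensor_map_pi (f : A -> A') (x : {freeg (A * B)%type / int}) :
  {morph f : a a' / a + a'} ->
  tensor_map f (\pi_(Quotient.quot (Defs.span (@bilinear_relation A B))) x) =
  \pi_(Quotient.quot (Defs.span (@bilinear_relation A' B))) (lift f x).
Proof.
move=> fD; apply/eqP; rewrite -Quotient.idealrBE -raddfB.
set y := repr _ - x.
have : y \in Defs.span (@bilinear_relation A B) by rewrite Quotient.idealrBE reprK.
pose S : {pred _} := fun z => lift f z \in Defs.span (@bilinear_relation A' B).
have SE z : (z \in S) = (lift f z \in Defs.span (@bilinear_relation A' B)) by [].
move=> /asboolP/(_ S); rewrite SE; apply.
  split=> [|u v]; rewrite !SE; first by rewrite raddf0 rpred0.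
  by move=> us vs; rewrite raddfB rpredB.
move=> z; rewrite SE => -[] [a [b [c ->]]]; rewrite !raddfB /= !liftU !scale1r /=.
  by apply/asboolP => U _; apply; left; exists (f a), (f b), c; rewrite fD.
by apply/asboolP => U _; apply; right; exists (f a), b, c.
Qed.

Lemma tensor_mapE (f : A -> A') (a : A) (b : B) : {morph f : a a' / a + a'} ->
  tensor_map f (tens a b) = tens (f a) b.
Proof. by move=> fD; rewrite /tens tensor_map_pi // liftU scale1r. Qed.

Lemma tensor_mapD (f : A -> A') : {morph f : a a' / a + a'} ->
  {morph @tensor_map A A' B f : x y / x + y}.
Proof.
move=> fD x y; rewrite -[x]reprK -[y]reprK -raddfD !tensor_map_pi //.
by rewrite -raddfD; congr (\pi _); rewrite raddfD.
Qed.

(** Induction on tensors: a representative in the free group is an integer combination of pairs, so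
    its class is the same combination of pure tensors. *)
Lemma tensorP (S : {pred tensor A B}) : zmod_closed S ->
  (forall a b, tens a b \in S) -> forall x, x \in S.
Proof.
move=> cS tS x; pose mS := GRing.isZmodClosed.Build _ S cS.
pose P : zmodClosed (tensor A B) := HB.pack S mS.
rewrite -[x]reprK -[repr x]freeg_sumE raddf_sum.
apply: (@rpred_sum _ P) => -[a b] _.
rewrite -[coeff _ _]intz -freegU_mulz raddfMz.
exact/(@rpredMz _ P)/tS.
Qed.

Lemma eq_tensor (V : zmodType) (F G : tensor A B -> V) :
  {morph F : x y / x + y} -> {morph G : x y / x + y} ->
  (forall a b, F (tens a b) = G (tens a b)) -> F =1 G.
Proof.
move=> FD GD FG.
(* [F] and [G] are bare functions, so compatibility with 0 and with differences is derived from that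
   with sums; their equalizer is then a subgroup. *)
have F0 (H : tensor A B -> V) : {morph H : x y / x + y} -> H 0 = 0.
  by move=> HD; apply: (addrI (H 0)); rewrite -HD !addr0.
have FB (H : tensor A B -> V) : {morph H : x y / x + y} ->
    {morph H : x y / x - y}.
  by move=> HD x y; apply: (addIr (H y)); rewrite -HD !subrK.
move=> x; apply/eqP; move: x; apply: (@tensorP [pred x | F x == G x]).
  split=> [|x y]; rewrite !inE; first by rewrite !F0.
  by move=> /eqP xFG /eqP yFG; rewrite !FB // xFG yFG.
by move=> a b; rewrite inE FG.
Qed.
End Tensor.

Lemma tensor_map_comp (A A' A'' B : zmodType) (f : A -> A') (g : A' -> A'') :
  {morph f : a a' / a + a'} -> {morph g : a a' / a + a'} ->
  @tensor_map A A'' B (g \o f) =1 @tensor_map A' A'' B g \o @tensor_map A A' B f.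
Proof.
move=> fD gD; have gfD : {morph g \o f : a a' / a + a'} by move=> a b /=; rewrite fD gD.
apply: eq_tensor => [|x y|a b]; first exact: tensor_mapD.
  by rewrite /= !tensor_mapD.
by rewrite /= !tensor_mapE.
Qed.

(** The correction term vanishes on pure tensors: $2d(a)\otimes b=d(a)\otimes 2b=0$ over
    $\mathbb{Z}_2$. *)
Lemma Gamma1_map_id_mod2 (A : zmodType) (f d : A -> A) :
  {morph f : a a' / a + a'} -> (forall a, f a = a + d a *+ 2) ->
  Gamma1_map f =1 id.
Proof.
move=> fD fE; apply: eq_tensor => // [|a b]; first exact: tensor_mapD.
rewrite /Gamma1_map tensor_mapE // fE mulr2n !tens_additivel -tens_additiver.
rewrite (_ : b + b = 0); last by rewrite -mulr2n -mulr_natl pchar_Zp // mul0r.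
rewrite (_ : tens (d a) 0 = 0) ?addr0 //.
by apply: (addrI (tens (d a) 0)); rewrite -tens_additiver !addr0.
Qed.

Lemma Gamma1_map_id (A : zmodType) : @Gamma1_map A A id =1 id.
Proof. by apply: (@Gamma1_map_id_mod2 _ _ (fun=> 0)) => // a; rewrite mul0rn addr0. Qed.

Lemma Gamma1_map_comp (A A' A'' : zmodType) (f : A -> A') (g : A' -> A'') :
  {morph f : a a' / a + a'} -> {morph g : a a' / a + a'} ->
  Gamma1_map (g \o f) =1 Gamma1_map g \o Gamma1_map f.
Proof. exact: tensor_map_comp. Qed.

(** * Additivity of the Hurewicz map *)

Section CubeTail.
Variables (R : realType) (k : nat).

(** The coordinate dropped here serves as the time parameter when a homotopy is turned into a
    singular cube. *)
Definition cube_tail (t : cube R k.+1) : cube R k :=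
  to_cube (fun j => crd t (fintype.lift ord0 j)).

Lemma cube_tailE t j : crd (cube_tail t) j = crd t (fintype.lift ord0 j).
Proof. by rewrite to_cubeE clampE // crd_in. Qed.

Lemma cube_tail_continuous : continuous cube_tail.
Proof. by apply: to_cube_continuous => j; exact: crd_continuous. Qed.

Lemma cube_tail_face0 e (t : cube R k) : cube_tail (face ord0 e t) = t.
Proof. by apply: cubeP => j; rewrite cube_tailE face_crd_lift. Qed.

Lemma cube_tail_face_crd e (t : cube R k) i :
  crd (cube_tail (face (fintype.lift ord0 i) e t)) i = e%:R.
Proof. by rewrite cube_tailE face_crd. Qed.

Lemma face_lift0_crd0 e (t : cube R k.+1) (i : 'I_k.+1) :
  crd (face (fintype.lift ord0 i) e t) ord0 = crd t ord0.
Proof.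
(* Direction 0 differs from the direction of the face, so it is a lifted index and keeps its
   coordinate. *)
rewrite (_ : ord0 = fintype.lift (fintype.lift ord0 i) ord0); last exact: val_inj.
by rewrite face_crd_lift; congr crd; exact: val_inj.
Qed.

End CubeTail.

Section HurewiczMorphism.
Variables (R : realType) (X : topologicalType).
Local Notation chain := (chain R X).
Local Notation cube1 c := (<< c >> : chain _).

Lemma homology_classP (A : set X) k (z w : Defs.cycle R A k) :
  homology_class z = homology_class w <->
  exists y : chain k.+1, val z - val w - bdry y \in negligible A.
Proof.
rewrite (rwP eqP) -Quotient.idealrBE.
by split=> [/asboolP|?]; [|apply/asboolP]; rewrite raddfB.
Qed.

Lemma homology_classD (A : set X) k (z w : Defs.cycle R A k) :
  homology_class (z + w) = homology_class z + homology_class w.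
Proof. exact: raddfD. Qed.

Variable x0 : X.

(** The homotopy itself, with time as coordinate 0, is the cube [c]: its two time faces are the ends
    of the homotopy. *)
Lemma bdry_homotopy k (f g : loop R x0 k) : htpy_class f = htpy_class g ->
  exists c, bdry (cube1 c) = cube1 (val g) - cube1 (val f).
Proof.
move=> /htpy_classP/homotopic_rel_ext[H [cH H0 H1 HA]].
have cc : continuous (fun t : cube R k.+1 => H (cube_tail t, crd t ord0)).
  exact: cts_comp2 (@cube_tail_continuous _ _) (@crd_continuous _ _ ord0) cH.
exists (cmap cc); rewrite bdryU big_ord_recl expr0 scale1r big1 ?addr0.
  by congr (<< _ >> - << _ >>); apply/continuousEP => t;
    rewrite /ccomp /cmap /= /mkcts /= cube_tail_face0 face_crd.
(* The homotopy is stationary on the boundary, so opposite faces in the other directions are both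
   constant and cancel. *)
move=> i _; rewrite (_ : ccomp _ _ = ccomp (cmap cc) (face (fintype.lift ord0 i) false)).
  by rewrite subrr scaler0.
apply/continuousEP => t; rewrite /ccomp /cmap /= /mkcts /=.
have bd e : cube_bd (cube_tail (face (fintype.lift ord0 i) e t)).
  by exists i; rewrite cube_tail_face_crd; case: e; [right|left].
by rewrite !HA ?(loopP f) //; exact: bd.
Qed.

(* The square (u, s) |-> s (1 + u) / 2 has the edges s / 2 and s at u = 0, 1, and 0
   and (1 + u) / 2 at s = 0, 1; reparametrizing f * g by it, these edges become f,
   f * g, the constant map, and g. *)
Lemma bdry_concat k (f g : loop R x0 k.+1) :
  exists c, bdry (cube1 c) - cube1 (val (cst_loop R x0 k)) =
    cube1 (val (concat f g)) - cube1 (val f) - cube1 (val g).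
Proof.
have cc : continuous (fun t : cube R k.+2 => val (concat f g)
    (upd0 (cube_tail t) (crd t (fintype.lift ord0 ord0) * (1 + crd t ord0) / 2))).
  apply: cts_comp (@cts_fun _ _ (val (concat f g))).
  apply: upd0_continuous; first exact: cube_tail_continuous.
  apply: ctsM (ctsM _ _) (ctsC _); first exact: crd_continuous.
  exact: ctsD (ctsC _) (@crd_continuous _ _ _).
exists (cmap cc); rewrite bdryU !big_ord_recl big1; last first.
  (* Beyond the two directions of the square, opposite faces are constant at [x0] and cancel. *)
  move=> i _; set j := fintype.lift _ _.
  rewrite (_ : ccomp _ _ = ccomp (cmap cc) (face j false)).
    by rewrite subrr scaler0.
  apply/continuousEP => t; rewrite /ccomp /cmap /= /mkcts /=.
  have bd e a : cube_bd (upd0 (cube_tail (face j e t)) a).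
    apply: (@upd0_bdN _ _ _ _ (fintype.lift ord0 i)) => //.
    by rewrite cube_tail_face_crd; case: e; [right|left].
  by rewrite !concat_bd //; exact: bd.
rewrite addr0 expr0 scale1r expr1 scaleN1r opprB.
have -> : ccomp (cmap cc) (face ord0 true) = val (concat f g).
  apply/continuousEP => t; rewrite /ccomp /cmap /= /mkcts /=.
  rewrite cube_tail_face0 face_crd_lift face_crd -[1 + _]/(2 : R).
  by rewrite mulfK ?upd0_id // pnatr_eq0.
have -> : ccomp (cmap cc) (face ord0 false) = val f.
  apply/continuousEP => t; rewrite /ccomp /cmap /= /mkcts /=.
  rewrite cube_tail_face0 face_crd_lift face_crd addr0 mulr1.
  have /andP[t0 t1] := crd_in t ord0.
  rewrite /concat_fun upd0E eqxx clampE; last by lra.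
  rewrite ifT; last by lra.
  by rewrite upd0_upd0 mulrC divfK ?upd0_id // pnatr_eq0.
have -> : ccomp (cmap cc) (face (fintype.lift ord0 ord0) false) = val (cst_loop R x0 k).
  apply/continuousEP => t; rewrite /ccomp /cmap /= /mkcts /=.
  by rewrite face_crd mul0r mul0r concat_bd //; exact: upd0_bd0.
have -> : ccomp (cmap cc) (face (fintype.lift ord0 ord0) true) = val g.
  apply/continuousEP => t; rewrite /ccomp /cmap /= /mkcts /=.
  rewrite face_crd mul1r face_lift0_crd0.
  have /andP[t0 t1] := crd_in t ord0.
  have tE : upd0 (cube_tail (face (fintype.lift ord0 ord0) true t)) (crd t ord0) = t.
    apply: cubeP => j; rewrite upd0E; have [->|j0] := eqVneq j ord0.
      by rewrite clampE ?crd_in.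
    rewrite cube_tailE; have [j' ->|jE] := unliftP ord0 j; last by rewrite jE eqxx in j0.
    rewrite (_ : fintype.lift ord0 (fintype.lift ord0 j') =
        fintype.lift (fintype.lift ord0 ord0) (fintype.lift ord0 j')).
      by rewrite face_crd_lift.
    exact: val_inj.
  rewrite /concat_fun upd0E eqxx clampE; last by lra.
  rewrite !upd0_upd0; case: ifPn => t2.
    (* The half belonging to [f] is met only at first coordinate 0, where both sides equal [x0]. *)
    rewrite valupd_bd1; last by lra.
    have t00 : crd t ord0 = 0 by lra.
    by rewrite loopP //; exists ord0; left.
  by rewrite (_ : 2 * _ - 1 = crd t ord0) ?tE //; field.
by rewrite addrAC addrA subrK.
Qed.

(** This disposes of the constant face left over in [bdry_concat]: a constant cube of positive
    dimension is degenerate. *)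
Lemma cst_negligible (A : set X) k : cube1 (val (cst_loop R x0 k)) \in negligible A.
Proof.
by apply/asboolP => c; rewrite domU1 inE => /eqP ->; left; exists ord0.
Qed.

(** [hurewicz] is computed on a chosen representative; by [bdry_homotopy] any homotopic loop gives a
    homologous cycle. *)
Lemma hurewiczE k (l : loop R x0 k) :
  hurewicz (htpy_class l) = homology_class (Cycle (loop_cycle l)).
Proof.
apply/homology_classP => /=.
have [c cE] := bdry_homotopy (esym (htpy_repr (htpy_class l))).
by exists (cube1 c); rewrite cE subrr rpred0.
Qed.

Lemma hurewiczM k (a b : homotopy_group R x0 k.+1) :
  hurewicz (a * b)%g = hurewicz a + hurewicz b.
Proof.
rewrite -[a]htpy_repr -[b]htpy_repr [(_ * _)%g]htpy_mulE !hurewiczE.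
rewrite -homology_classD; apply/homology_classP => /=.
have [c cE] := bdry_concat (repr a) (repr b).
exists (cube1 c); rewrite opprD addrA -cE.
by rewrite addrAC subrr add0r rpredN cst_negligible.
Qed.

Lemma hurewicz1 k : hurewicz (1%g : homotopy_group R x0 k.+1) = 0.
Proof.
apply: (addrI (hurewicz (1%g : homotopy_group R x0 k.+1))).
by rewrite -hurewiczM mulg1 addr0.
Qed.

End HurewiczMorphism.

(** * The group of $\Gamma$-isomorphisms *)

Lemma mem_Gamma_isos (R : realType) (X : topologicalType) (K : CW_structure R X)
    (x0 : skel K 0) n (S : Gamma_sequence x0 n) f :
  f \in Gamma_isos S <->
  exists Omega : {multiplicative pi_X x0 n.+1 -> pi_X x0 n.+1},
    [/\ forall z, gs_b S (f.1.1 z) = Gamma1_map f.2 (gs_b S z),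
        forall u, Omega (gs_i S u) = gs_i S (Gamma1_map f.2 u) &
        forall a, hurewicz (Omega a) = f.1.2 (hurewicz a)].
Proof. by split=> /asboolP. Qed.

Section GammaIsosGroup.
Variables (R : realType) (X : topologicalType) (K : CW_structure R X).
Variables (x0 : skel K 0) (n : nat) (S : Gamma_sequence x0 n).
Implicit Types f g : aut (HZ R X n.+2) * aut (HZ R X n.+1) * aut (HZ R X n).

Lemma Gamma1_map_autM (A : zmodType) (f g : aut A) :
  Gamma1_map (f * g)%g =1 Gamma1_map f \o Gamma1_map g.
Proof. exact: Gamma1_map_comp (autD g) (autD f). Qed.

Lemma Gamma1_map_autK (A : zmodType) (f : aut A) :
  cancel (Gamma1_map f) (Gamma1_map f^-1%g).
Proof.
move=> u; rewrite -[LHS](Gamma1_map_autM f^-1%g f) mulVg; exact: Gamma1_map_id.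
Qed.

Lemma Gamma1_map_autVK (A : zmodType) (f : aut A) :
  cancel (Gamma1_map f^-1%g) (Gamma1_map f).
Proof. by move=> u; rewrite -{1}[f]invgK Gamma1_map_autK. Qed.

Lemma autK (A : zmodType) (f : aut A) : cancel f f^-1%g.
Proof. by move=> x; rewrite -[LHS]/((f^-1 * f)%g x) mulVg. Qed.

Lemma autVK (A : zmodType) (f : aut A) : cancel f^-1%g f.
Proof. by move=> x; rewrite -[LHS]/((f * f^-1)%g x) mulgV. Qed.

(* The five lemma for the Gamma-sequence; Omega is not assumed to be invertible. *)
Lemma Omega_bij f (Omega : {multiplicative pi_X x0 n.+1 -> pi_X x0 n.+1}) :
  (forall z, gs_b S (f.1.1 z) = Gamma1_map f.2 (gs_b S z)) ->
  (forall u, Omega (gs_i S u) = gs_i S (Gamma1_map f.2 u)) ->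
  (forall a, hurewicz (Omega a) = f.1.2 (hurewicz a)) ->
  bijective Omega.
Proof.
move=> fb fi fh.
(* Diagram chase: [a] dies in homology, hence comes from some [u]; the image of [u] under
   $\Gamma_n^1(f_n)$ lies in the image of [gs_b], and so does [u]. *)
have inj a : Omega a = 1%g -> a = 1%g.
  move=> a1; have /(gs_exact_pi S)[u ua] : hurewicz a = 0.
    apply: (bij_inj (aut_bij f.1.2)); rewrite -fh a1 hurewicz1.
    by apply: (addrI (f.1.2 0)); rewrite -autD !addr0.
  move: a1; rewrite -ua -[to_X _]/(gs_i S u) fi.
  move=> /(gs_exact_Gamma S)[z zu]; apply/(gs_exact_Gamma S).
  exists (f.1.1^-1%g z); apply: (can_inj (Gamma1_map_autK f.2)).
  by rewrite -fb autVK.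
have surj a : exists a', Omega a' = a.
  have [c cE] := gs_exact_H S (f.1.2^-1%g (hurewicz a)).
  have /(gs_exact_pi S)[u uE] : hurewicz ((Omega c)^-1 * a)%g = 0.
    apply: (addrI (hurewicz (Omega c))).
    by rewrite -hurewiczM mulVKg addr0 fh cE autVK.
  (* [c] lifts the pulled-back Hurewicz image of [a]; the second factor corrects the remaining
     error, which exactness places in the image of [gs_i]. *)
  exists (c * gs_i S (Gamma1_map f.2^-1%g u))%g.
  by rewrite gmulfM fi Gamma1_map_autVK [gs_i S u]uE mulVKg.
have Oinj : injective Omega.
  move=> a b ab; apply/divg1_eq/inj; rewrite gmulfM ab -gmulfM mulgV.
  (* This is $\Omega(1)=1$, by cancellation. *)
  by apply: (mulgI (Omega 1%g)); rewrite -gmulfM !mulg1.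
apply: (@Bijective _ _ _ (fun a => projT1 (cid (surj a)))) => a.
  exact/Oinj/(projT2 (cid (surj _))).
exact: (projT2 (cid (surj _))).
Qed.

(** A quotient $fg^{-1}$ is realized by $\Omega_f\Omega_g^{-1}$, the inverse being supplied by
    [Omega_bij]. *)
Lemma Gamma_isos_group : group_closed (Gamma_isos S).
Proof.
split=> [|f g].
  apply/mem_Gamma_isos; exists idfun; split=> // [z|u].
    by rewrite Gamma1_map_id.
  by rewrite Gamma1_map_id.
move=> /mem_Gamma_isos[Of [fb fi fh]] /mem_Gamma_isos[Og [gb gi gh]].
have [Og' OgK Og'K] := Omega_bij gb gi gh.
have Og'M : {morph Og' : x y / (x * y)%g}.
  by move=> x y; apply: (can_inj OgK); rewrite gmulfM !Og'K.
pose mOg' := isMultiplicative.Build _ _ Og' Og'M.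
pose Om : {multiplicative _ -> _} := HB.pack Og' mOg'.
apply/mem_Gamma_isos; exists (Of \o Om); split=> [z|u|a].
- rewrite Gamma1_map_autM /= fb; congr Gamma1_map.
  (* Writing $z=g(g^{-1}z)$ turns the square of $g$ into that of $g^{-1}$. *)
  by rewrite -[in RHS](autVK g.1.1 z) gb Gamma1_map_autK.
- rewrite Gamma1_map_autM /= -fi; congr (Of _); apply: (can_inj OgK).
  by rewrite Og'K gi Gamma1_map_autVK.
- by rewrite /= fh; congr (f.1.2 _); rewrite -[in RHS](Og'K a) gh autK.
Qed.

End GammaIsosGroup.

(** * Transvections congruent to the identity modulo 2 *)

Section EvenTransvection.
Variables (A G : zmodType) (phi : {additive A -> (int * int * G)%type}).
Variables (psi : (int * int * G)%type -> A).
Variables (phiK : cancel phi psi) (psiK : cancel psi phi).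

(** Half of the displacement, kept apart so that [shear] has the shape $x+2d(x)$ required by
    [Gamma1_map_id_mod2]. *)
Definition shear_part (m : int) (x : A) : A := psi (m * (phi x).1.2, 0, 0).

Definition shear (m : int) (x : A) : A := x + shear_part m x *+ 2.

(** The coordinate formula through which the identities below are checked: additivity is given for
    [phi], while [psi] is a bare inverse. *)
Lemma phi_shear m x :
  phi (shear m x) = ((phi x).1.1 + m * (phi x).1.2 *+ 2, (phi x).1.2, (phi x).2).
Proof.
rewrite raddfD raddfMn psiK mulr2n; case: (phi x) => [[a b] g] /=.
by rewrite mulr2n; congr (_, _, _); rewrite /= ?addr0.
Qed.

Lemma shearD m : {morph shear m : x y / x + y}.
Proof.
move=> x y; apply: (can_inj phiK); rewrite [RHS]raddfD !phi_shear [phi (x + y)]raddfD.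
case: (phi x) (phi y) => [[a b] g] [[a' b'] g'] /=.
by congr (_, _, _) => /=; ring.
Qed.

(** The second coordinate is unchanged, so the displacements for $m$ and $-m$ are opposite. *)
Lemma shearK m : cancel (shear m) (shear (- m)).
Proof.
move=> x; apply: (can_inj phiK); rewrite !phi_shear /=.
by case: (phi x) => [[a b] g] /=; congr (_, _, _); ring.
Qed.

Definition shear_aut m : aut A :=
  Aut (@shearD m) (Bijective (@shearK m)
    (fun x => etrans (congr1 (fun p => shear p (shear (- m) x)) (esym (opprK m)))
                     (shearK (- m) x))).

Lemma shear_aut_inj : injective shear_aut.
Proof.
(* At the second basis vector of $\mathbb{Z}^2$ the first coordinate of the image is $2m$, which
   determines $m$. *)
move=> m p /(congr1 (fun f : aut A => phi (f (psi (0, 1, 0))))) /=.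
by rewrite !phi_shear psiK /= => -[]; lia.
Qed.

End EvenTransvection.

Theorem proposition3p9 (R : realType) (n : nat) (X : topologicalType)
    (K : CW_structure R X) (x0 : skel K 0) (S : Gamma_sequence x0 n)
    (G : zmodType) (phi : {additive HZ R X n -> (int * int * G)%type}) :
  (3 <= n)%N -> A2_polyhedron n K -> finite_type R X -> bijective phi ->
  group_closed (Gamma_isos S) /\ infinite_set [set f | f \in Gamma_isos S].
Proof.
move=> _ _ _ [psi phiK psiK]; split; first exact: Gamma_isos_group.
pose F (m : nat) : aut (HZ R X n.+2) * aut (HZ R X n.+1) * aut (HZ R X n) :=
  (1%g, 1%g, shear_aut phiK psiK m%:Z).
have F_iso m : F m \in Gamma_isos S.
  have idE : Gamma1_map (shear_aut phiK psiK m%:Z) =1 id.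
    by apply: (@Gamma1_map_id_mod2 _ _ (shear_part phi psi m%:Z)); first exact: autD.
  by apply/mem_Gamma_isos; exists idfun; split=> // ?; rewrite /= idE.
have F_inj : injective F by move=> m p /(congr1 snd)/shear_aut_inj[].
(* Finiteness would pass to the preimage under the injective [F], which is all of $\mathbb{N}$. *)
move=> /(@finite_preimage _ _ _ F) fin; apply: infinite_nat.
rewrite (_ : setT = F @^-1` [set f | f \in Gamma_isos S]).
  by apply: fin => ? ? _ _ /F_inj.
by apply/seteqP; split=> m // _; exact: F_iso.
Qed.
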